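(* Assume that $g$ is $L_g$-Lipschitz continuous, i.e. $|g(z)-g(z')|\le L_g\|z-z'\|$ for all $z,z'\in\mathbb{R}^d$. Then the sequence $x_k$ generated by the composite conditional gradient algorithm with the approximate (additive-error) linear minimization oracle described in the context, with $\delta>0$, satisfies $$F(x_k)-F^\star\;\le\;2D_{\mathcal{X}}^2\left(\frac{L_f}{k}+\frac{\|A\|^2}{\beta_0\sqrt{k}}\right)(1+\delta)+\frac{\beta_0L_g^2}{2\sqrt{k}}.$$ If $\delta$ is known, $\beta_0$ can be optimized from this bound.
   Context: Problem: $\min_{x\in\mathcal{X}} F(x) := f(x)+g(Ax)$, where $\mathcal{X}\subset\mathbb{R}^n$ is nonempty, compact and convex; $f$ is a proper closed convex function, differentiable on $\mathcal{X}$ and $L_f$-smooth, i.e. $\|\nabla f(x)-\nabla f(x')\|\le L_f\|x-x'\|$ for all $x,x'\in\mathcal{X}$; $A\in\mathbb{R}^{d\times n}$; and $g$ is a proper closed convex function on $\mathbb{R}^d$ (possibly non-smooth). Norms of vectors are Euclidean, and $\|A\|$ is the spectral norm. The set of minimizers is assumed nonempty; $x^\star$ is a minimizer and $F^\star=F(x^\star)$. $D_{\mathcal{X}}=\max_{x,x'\in\mathcal{X}}\|x-x'\|$. Also $\mathrm{prox}_{\phi}(v)=\arg\min_x \phi(x)+\frac12\|x-v\|^2$. Algorithm with additive-error oracle: given $x_1\in\mathcal{X}$, $\beta_0>0$, for $k=1,2,\dots$ set $\eta_k=\frac{2}{k+1}$, $\beta_k=\frac{\beta_0}{\sqrt{k+1}}$,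 $v_k=\beta_k\nabla f(x_k)+A^\top\big(Ax_k-\mathrm{prox}_{\beta_k g}(Ax_k)\big)$; the oracle returns $\tilde s_k\in\mathcal{X}$ such that $$\langle v_k,\tilde s_k\rangle\le\langle v_k,s_k\rangle+\delta\,\frac{\eta_k}{2}D_{\mathcal{X}}^2\left(L_f+\frac{\|A\|^2}{\beta_k}\right),$$ where $s_k\in\arg\min_{x\in\mathcal{X}}\langle v_k,x\rangle$ is an exact solution; set $x_{k+1}=x_k+\eta_k(\tilde s_k-x_k)$.
   Formalization: The oracle error is measured along v_k/β_k instead of v_k (the tolerance is multiplied by β_k), and the bound is claimed for k ≥ 2 only; as printed it fails, e.g. f(x)=x, g=0, A=1 on [0,1] with β_0=δ=1, and at k=1 for arbitrary x_1. *)

(* Defs.v *)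
From HB Require Import structures.
From mathcomp Require Export all_boot all_order all_algebra.
From mathcomp Require Export all_classical all_reals all_analysis.

Set Implicit Arguments.
Unset Strict Implicit.
Unset Printing Implicit Defensive.

Import Order.TTheory GRing.Theory Num.Theory.
Import numFieldNormedType.Exports.

Local Open Scope classical_set_scope.
Local Open Scope ring_scope.

Definition dotv (R : realType) n (u v : 'cV[R]_n) : R :=
  \sum_(i < n) u i 0 * v i 0.

(* The library norm [`|u|] on matrices is the max norm; only its topology,
   which is the usual one, is used here. *)
Definition norm2 (R : realType) n (u : 'cV[R]_n) : R := Num.sqrt (dotv u u).

Definition spectral_norm (R : realType) d n (A : 'M[R]_(d, n)) : R :=
  sup [set norm2 (A *m x) | x in [set x : 'cV[R]_n | norm2 x <= 1]].

Definition diam (R : realType) n (X : set 'cV[R]_n) : R :=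
  sup [set norm2 (p.1 - p.2) | p in X `*` X].

Definition proper_closed_convex (R : realType) n (f : 'cV[R]_n -> \bar R) :=
  [/\ (exists x, f x < +oo)%E,
      (forall x, -oo < f x)%E,
      lower_semicontinuous f &
      (forall (x y : 'cV[R]_n) (t : R), (0 < t < 1)%R ->
        f (t *: x + (1 - t) *: y)%R <= t%:E * f x + (1 - t)%:E * f y)%E].

(* Differentiability of an extended-real-valued function includes finiteness
   near the point. *)
Definition ediff (R : realType) n (f : 'cV[R]_n -> \bar R) (x : 'cV[R]_n) :=
  (\forall y \near x, f y \is a fin_num) /\
  differentiable (fine \o f : 'cV[R]_n -> R^o) x.

Definition grad (R : realType) n (f : 'cV[R]_n -> \bar R) (x : 'cV[R]_n) :
    'cV[R]_n :=
  \col_(i < n) 'd (fine \o f : 'cV[R]_n -> R^o) x (delta_mx i 0).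

Definition smooth_on (R : realType) n (X : set 'cV[R]_n)
    (f : 'cV[R]_n -> \bar R) (Lf : R) :=
  (forall x, X x -> ediff f x) /\
  (forall x x', X x -> X x' ->
    norm2 (grad f x - grad f x') <= Lf * norm2 (x - x')).

(* This forces [g] to be finite everywhere: [+oo - +oo = -oo], so the left-hand
   side is [+oo] as soon as one of the two values is infinite. *)
Definition elipschitz (R : realType) d (g : 'cV[R]_d -> \bar R) (Lg : R) :=
  forall z z', (`|g z - g z'| <= (Lg * norm2 (z - z'))%:E)%E.

Definition argmin (R : realType) (T : Type) (X : set T) (phi : T -> \bar R) :
    set T :=
  [set x | X x /\ forall y, X y -> (phi x <= phi y)%E].

(* The minimizer exists and is unique when [phi] is proper, closed and convex;
   the default value 0 of [xget] is then irrelevant. *)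
Definition prox (R : realType) d (phi : 'cV[R]_d -> \bar R) (v : 'cV[R]_d) :
    'cV[R]_d :=
  xget 0 (argmin setT
    (fun z => phi z + (2^-1 * norm2 (z - v) ^+ 2)%R%:E)%E).

Definition objective (R : realType) d n (f : 'cV[R]_n -> \bar R)
    (g : 'cV[R]_d -> \bar R) (A : 'M[R]_(d, n)) (x : 'cV[R]_n) : \bar R :=
  (f x + g (A *m x))%E.

Definition eta (R : realType) (k : nat) : R := 2 / k.+1%:R.

Definition beta (R : realType) (beta0 : R) (k : nat) : R :=
  beta0 / Num.sqrt k.+1%:R.

Definition direction (R : realType) d n (f : 'cV[R]_n -> \bar R)
    (g : 'cV[R]_d -> \bar R) (A : 'M[R]_(d, n)) (b : R) (x : 'cV[R]_n) :
    'cV[R]_n :=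
  b *: grad f x +
  A^T *m (A *m x - prox (fun z => b%:E * g z)%E (A *m x)).

(* Index 0 of the sequences is unused.
   The oracle error is measured along [(beta_k)^-1 v_k], the gradient at [x_k]
   of [f] plus the Moreau envelope of [g] composed with [A], of which
   [L_f + ||A||^2 / beta_k] is the smoothness constant.  Along [v_k] itself this
   tolerance decays no faster than [v_k] does, and no rate holds: for
   [f x = x], [g = 0], [A = 1] on [0, 1] with [L_f = 0] and
   [beta0 = delta = 1], the oracle could return 1 forever. *)
Definition inexact_cgm (R : realType) d n (X : set 'cV[R]_n)
    (f : 'cV[R]_n -> \bar R) (g : 'cV[R]_d -> \bar R) (A : 'M[R]_(d, n))
    (Lf beta0 delta : R) (x s st : nat -> 'cV[R]_n) :=
  X (x 1%N) /\
  forall k : nat, (0 < k)%N ->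
    let b := beta beta0 k in
    let v := direction f g A b (x k) in
    [/\ argmin X (fun y => (dotv v y)%:E) (s k),
        X (st k),
        dotv (b^-1 *: v) (st k) <= dotv (b^-1 *: v) (s k) +
          delta * (eta R k / 2) * diam X ^+ 2 *
            (Lf + spectral_norm A ^+ 2 / b) &
        x k.+1 = x k + eta R k *: (st k - x k)].

Definition rate (R : realType) (D Lf nA Lg delta beta0 : R) (k : nat) : R :=
  2 * D ^+ 2 * (Lf / k%:R + nA ^+ 2 / (beta0 * Num.sqrt k%:R)) * (1 + delta)
  + beta0 * Lg ^+ 2 / (2 * Num.sqrt k%:R).

(* Main.v *)
Require Import Defs.
From mathcomp Require Import ring lra.
Import Order.TTheory GRing.Theory Num.Theory.
Import numFieldNormedType.Exports.
Local Open Scope classical_set_scope.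
Local Open Scope ring_scope.

(** The method is conditional gradient on the smoothed objective
    [F_b x = f x + g_b (A x)], where [g_b] is the Moreau envelope of [g] with
    parameter [b], while [b = beta_k] decreases.  The vector [(beta_k)^-1 v_k]
    is the gradient of [F_b] at [x_k], and [F_b] has curvature
    [Lf + ||A||^2 / b] on [X] ([smoothed_descent]).

    Write [q_k] for the gradient of the envelope at [A x_k], and
    [S_(k+1) = F_(beta_k) (x_(k+1)) - F xstar].  Three estimates make the
    rate work.
    - The linearization of [F_b] at [x_k] stays below [F] with a margin
      [b / 2 * |q_k|^2] ([smoothed_gap]): the linearization of the envelope is
      the tangent to [g] at the proximal point, lowered by that amount.
      Combined with the curvature bound and the oracle tolerance, this gives
      one step of descent ([cgm_step]).
    - Passing from [beta_(k-1)] to [beta_k] raises the envelope at [A x_k] by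
      at most [(beta_(k-1) - beta_k) / 2 * |q_k|^2]
      ([moreau_change_param]).  With [eta_k = 2 / (k + 1)] and
      [beta_k = beta0 / sqrt (k + 1)] the margin above absorbs this increase,
      so no term in [q_k] survives.
    - What remains is
      [k (k + 1) S_(k+1) <= (k - 1) k S_k
         + 2 k / (k + 1) * (1 + delta) * D^2 * (Lf + ||A||^2 / beta_k)],
      which telescopes ([rate_recursion], [smoothed_rate]).

    Since [g] is [Lg]-Lipschitz, [g <= g_b + b * Lg^2 / 2] ([moreau_lower]),
    and the choice [b = beta_(k-1)] turns the bound on [S_k] into the rate.
    The step of index 1 has [eta_1 = 1], so nothing about [x_1] enters.

    As a function of [beta0] the bound is a constant plus a multiple of
    [c / beta0 + beta0 * Lg^2] with [c] independent of [k], hence one value of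
    [beta0] is optimal for every [k] ([rate_minimizer]). *)

Set Implicit Arguments.
Unset Strict Implicit.
Unset Printing Implicit Defensive.

(** * Euclidean norm, spectral norm and diameter *)

Lemma closed_dist_le (R : realType) (V : normedModType R) (z : V) (r : R) :
  closed [set u | `|u - z| <= r].
Proof.
have -> : [set u | `|u - z| <= r] = (fun u => `|u - z|) @^-1` [set x | x <= r] by [].
apply: closed_comp; last exact: closed_le.
by move=> u _; apply: cvg_norm; apply: cvgB; [exact: cvg_id|exact: cvg_cst].
Qed.

Section Euclid.
Variables (R : realType) (n : nat).
Implicit Types u v w : 'cV[R]_n.

Lemma dotvC u v : dotv u v = dotv v u.
Proof. by apply: eq_bigr => i _; rewrite mulrC. Qed.

Lemma dotvDl u v w : dotv (u + v) w = dotv u w + dotv v w.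
Proof. by rewrite -big_split; apply: eq_bigr => i _; rewrite mxE mulrDl. Qed.

Lemma dotvZl a u v : dotv (a *: u) v = a * dotv u v.
Proof. by rewrite mulr_sumr; apply: eq_bigr => i _; rewrite mxE mulrA. Qed.

Lemma dotvDr u v w : dotv u (v + w) = dotv u v + dotv u w.
Proof. by rewrite dotvC dotvDl !(dotvC u). Qed.

Lemma dotvZr a u v : dotv u (a *: v) = a * dotv u v.
Proof. by rewrite dotvC dotvZl dotvC. Qed.

Lemma dotvNl u v : dotv (- u) v = - dotv u v.
Proof. by rewrite -scaleN1r dotvZl mulN1r. Qed.

Lemma dotvNr u v : dotv u (- v) = - dotv u v.
Proof. by rewrite dotvC dotvNl dotvC. Qed.

Definition dotvE := (dotvDl, dotvDr, dotvNl, dotvNr, dotvZl, dotvZr).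

Lemma dotvv_ge0 u : 0 <= dotv u u.
Proof. by apply: sumr_ge0 => i _; rewrite -expr2 sqr_ge0. Qed.

Lemma dotvv_eq0 u : dotv u u = 0 -> u = 0.
Proof.
move=> /eqP; rewrite psumr_eq0 => [/allP u0|i _]; last by rewrite -expr2 sqr_ge0.
apply/colP => i; rewrite mxE.
by have := u0 i (mem_index_enum i); rewrite /= mulf_eq0 orbb => /eqP.
Qed.

Lemma norm2_ge0 u : 0 <= norm2 u.
Proof. exact: sqrtr_ge0. Qed.

Lemma norm2_sqr u : norm2 u ^+ 2 = dotv u u.
Proof. by rewrite sqr_sqrtr ?dotvv_ge0. Qed.

Lemma norm2_sqrD u v :
  norm2 (u + v) ^+ 2 = norm2 u ^+ 2 + 2 * dotv u v + norm2 v ^+ 2.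
Proof. by rewrite !norm2_sqr !dotvE (dotvC v u); ring. Qed.

Lemma norm20 : norm2 (0 : 'cV[R]_n) = 0.
Proof. by rewrite /norm2 -(scale0r (0 : 'cV[R]_n)) dotvZl mul0r sqrtr0. Qed.

Lemma norm2Z a u : norm2 (a *: u) = `|a| * norm2 u.
Proof.
by rewrite /norm2 dotvZl dotvZr mulrA -expr2 sqrtrM ?sqr_ge0// sqrtr_sqr.
Qed.

Lemma norm2N u : norm2 (- u) = norm2 u.
Proof. by rewrite -scaleN1r norm2Z normrN1 mul1r. Qed.

Lemma norm2_distC u v : norm2 (u - v) = norm2 (v - u).
Proof. by rewrite -norm2N opprB. Qed.

Lemma norm2_eq0 u : norm2 u = 0 -> u = 0.
Proof. by move=> u0; apply: dotvv_eq0; rewrite -norm2_sqr u0 expr0n. Qed.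

(** Expand [|norm2 v *: u - norm2 u *: v|^2 >= 0], where both squares equal
    [(norm2 u * norm2 v)^2]. *)
Lemma cauchy_schwarz u v : dotv u v <= norm2 u * norm2 v.
Proof.
have [/norm2_eq0 ->|u0] := eqVneq (norm2 u) 0.
  by rewrite norm20 mul0r -(scale0r 0) dotvZl mul0r.
have [/norm2_eq0 ->|v0] := eqVneq (norm2 v) 0.
  by rewrite norm20 mulr0 -(scale0r 0) dotvZr mul0r.
have uv : 0 < norm2 u * norm2 v by rewrite mulr_gt0// lt_def norm2_ge0 ?u0 ?v0.
have := dotvv_ge0 (norm2 v *: u - norm2 u *: v).
rewrite !dotvE -!norm2_sqr (dotvC v u) => h.
by rewrite -(ler_pM2l uv); nra.
Qed.

Lemma norm2D u v : norm2 (u + v) <= norm2 u + norm2 v.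
Proof.
rewrite -(ler_pXn2r (ltn0Sn 1)) ?nnegrE ?addr_ge0 ?norm2_ge0//.
by rewrite norm2_sqrD; have := cauchy_schwarz u v; nra.
Qed.

Lemma norm2_lipschitz u v : `|norm2 u - norm2 v| <= norm2 (u - v).
Proof.
have := norm2D (u - v) v; have := norm2D (v - u) u.
rewrite !subrK (norm2_distC v) => h1 h2.
by rewrite ler_norml; apply/andP; split; lra.
Qed.

Lemma mxnorm_coord m k (M : 'M[R]_(m, k)) i j : `|M i j| <= `|M|.
Proof.
rewrite [leRHS]/Num.norm /= mx_normrE.
by apply/bigmax_geP; right; exists (i, j).
Qed.

(** The topology on columns comes from the max norm; this bound and
    [mxnorm_le_norm2] move boundedness and continuity between the two norms. *)
Lemma norm2_le_mxnorm u : norm2 u <= n%:R * `|u|.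
Proof.
rewrite -(ler_pXn2r (ltn0Sn 1)) ?nnegrE ?mulr_ge0 ?norm2_ge0//.
rewrite norm2_sqr.
apply: (@le_trans _ _ (\sum_(i < n) `|u| ^+ 2)).
  apply: ler_sum => i _; rewrite -expr2 -real_normK ?num_real//.
  by rewrite ler_pXn2r ?nnegrE// mxnorm_coord.
rewrite sumr_const card_ord -[X in X <= _]mulr_natl exprMn.
rewrite ler_wpM2r ?sqr_ge0// -natrX ler_nat expnS expn1.
by case: (n) => // m; rewrite leq_pmulr.
Qed.

Lemma mxnorm_le_norm2 u : `|u| <= norm2 u.
Proof.
rewrite [leLHS]/Num.norm /= mx_normrE; apply: bigmax_le => [|[i j] _] /=.
  exact: norm2_ge0.
rewrite (ord1 j) -(ler_pXn2r (ltn0Sn 1)) ?nnegrE ?norm2_ge0//.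
rewrite real_normK ?num_real// norm2_sqr /dotv (bigD1 i)//= -expr2 lerDl.
by apply: sumr_ge0 => k _; rewrite -expr2 sqr_ge0.
Qed.

Lemma lipschitz2_continuous (h : 'cV[R]_n -> R) (L : R) :
  (forall u v, `|h u - h v| <= L * norm2 (u - v)) -> continuous h.
Proof.
move=> hL u; apply/(@cvgrPdist_lt _ _ _ (nbhs u)) => e e0.
have K0 : 0 < `|L| * n%:R + 1 by rewrite ltr_wpDl// mulr_ge0.
near=> v.
have uv : `|u - v| < e / (`|L| * n%:R + 1).
  by near: v; have /cvgrPdist_lt := @cvg_id _ (nbhs u); apply; rewrite divr_gt0.
apply: (le_lt_trans (hL u v)); move: uv; rewrite ltr_pdivlMr//.
apply: le_lt_trans.
have := norm2_le_mxnorm (u - v); have := norm2_ge0 (u - v).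
have := normr_ge0 (u - v); have := ler_norm L; have := normr_ge0 L.
move: (norm2 _) `|u - v| `|L| (n%:R : R) => a b l m l0 lL b0 a0 ab.
apply: (@le_trans _ _ (l * a)); first by rewrite ler_wpM2r.
apply: (@le_trans _ _ (l * (m * b))); first by rewrite ler_wpM2l.
by rewrite mulrDr mulr1 mulrA (mulrC b) lerDl.
Unshelve. all: end_near. Qed.

(** Heine-Borel holds for row vectors, and transposition is an isometry for
    the max norm. *)
Lemma closed_ball_compact (z : 'cV[R]_n) (r : R) :
  compact [set u | `|u - z| <= r].
Proof.
have trN (u : 'rV[R]_n) : `|u^T| = `|u|.
  apply/eqP; rewrite eq_le; apply/andP; split.
    rewrite [leLHS]/Num.norm /= mx_normrE; apply: bigmax_le => // -[i j] _ /=.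
    by rewrite mxE mxnorm_coord.
  rewrite [leLHS]/Num.norm /= mx_normrE; apply: bigmax_le => // -[i j] _ /=.
  by have := mxnorm_coord u^T j i; rewrite mxE.
have trC : continuous (@trmx R 1 n).
  move=> u; apply/(@cvgrPdist_lt _ _ _ (nbhs u)) => e e0; near=> v.
  rewrite -linearB /= trN.
  by near: v; have /cvgrPdist_lt := @cvg_id _ (nbhs u); apply.
have -> : [set u | `|u - z| <= r] = trmx @` [set u : 'rV[R]_n | `|u - z^T| <= r].
  apply/seteqP; split=> [u /= uz|_ [u /= uz <-]].
    by exists u^T; rewrite ?trmxK// -trN linearB /= !trmxK.
  by rewrite -(trmxK z) -linearB /= trN.
apply: continuous_compact; first by apply: continuous_subspaceT.
apply: bounded_closed_compact.
  exists (r + `|z^T|); split; first exact: num_real.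
  move=> M rM u /= uz; rewrite -(subrK z^T u).
  by apply: (le_trans (ler_normD _ _)); rewrite (le_trans _ (ltW rM))// lerD2r.
exact: closed_dist_le.
Unshelve. all: end_near. Qed.

End Euclid.

Section Matrix.
Variables (R : realType) (d n : nat) (A : 'M[R]_(d, n)).

Lemma dotv_trmx_mul (q : 'cV[R]_d) (y : 'cV[R]_n) :
  dotv (A^T *m q) y = dotv q (A *m y).
Proof.
have dE m (u v : 'cV[R]_m) : dotv u v = (u^T *m v) 0 0.
  by rewrite mxE; apply: eq_bigr => i _; rewrite mxE.
by rewrite !dE trmx_mul trmxK mulmxA.
Qed.

Let values := [set norm2 (A *m x) | x in [set x : 'cV[R]_n | norm2 x <= 1]].

(** The Frobenius norm of [A] bounds its values on the unit ball, by
    Cauchy-Schwarz on each row; without a bound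
    [sup] would be a default value. *)
Lemma spectral_norm_has_sup : has_sup values.
Proof.
split; first by exists (norm2 (A *m 0)), 0 => //=; rewrite norm20 ler01.
pose F := \sum_(i < d) dotv (row i A)^T (row i A)^T.
exists (Num.sqrt F) => _ [x /= x1 <-]; rewrite ler_wsqrtr//.
apply: ler_sum => i _; rewrite -expr2.
have rowE : (A *m x) i 0 = dotv (row i A)^T x.
  by rewrite mxE; apply: eq_bigr => j _; rewrite !mxE.
have cs y : norm2 y <= 1 -> dotv (row i A)^T y <= norm2 (row i A)^T.
  by move=> y1; apply: (le_trans (cauchy_schwarz _ _)); rewrite ler_piMr ?norm2_ge0.
rewrite -norm2_sqr rowE -real_normK ?num_real// ler_pXn2r ?nnegrE ?norm2_ge0//.
by rewrite ler_norml cs// lerNl -dotvNr cs ?norm2N.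
Qed.

Lemma norm2_mulmx_le x : norm2 (A *m x) <= spectral_norm A * norm2 x.
Proof.
have [/norm2_eq0 ->|x0] := eqVneq (norm2 x) 0;
  first by rewrite mulmx0 !norm20 mulr0.
have x_gt0 : 0 < norm2 x by rewrite lt_def norm2_ge0 x0.
rewrite -ler_pdivrMr// mulrC.
rewrite -[X in X * _](gtr0_norm (_ : 0 < (norm2 x)^-1)) ?invr_gt0//.
rewrite -norm2Z scalemxAr; apply: ub_le_sup; first by case: spectral_norm_has_sup.
by exists ((norm2 x)^-1 *: x) => //=; rewrite norm2Z gtr0_norm ?invr_gt0// mulVf.
Qed.

End Matrix.

Section Diameter.
Variables (R : realType) (n : nat) (X : set 'cV[R]_n).
Hypothesis X_compact : compact X.

Lemma norm2_le_diam x y : X x -> X y -> norm2 (x - y) <= diam X.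
Proof.
move=> Xx Xy; apply: ub_le_sup; last by exists (x, y).
have [M [_ XM]] := compact_bounded X_compact.
have XM1 u : X u -> `|u| <= M + 1 by apply: XM; rewrite ltrDl.
exists (n%:R * (M + 1 + (M + 1))) => _ [[u v] /= [Xu Xv] <-].
apply: (le_trans (norm2_le_mxnorm _)); rewrite ler_wpM2l//.
by apply: (le_trans (ler_normB _ _)); rewrite lerD ?XM1.
Qed.

End Diameter.

(** * The Moreau envelope of a Lipschitz convex function *)

Lemma continuous_quadratic (R : realType) (T : topologicalType) (a c : T -> R)
    (r s : R) : continuous a -> continuous c ->
  continuous (fun u => r * a u + s * c u ^+ 2).
Proof.
move=> ca cc u; apply: cvgD; apply: cvgM; try exact: cvg_cst; first exact: ca.
by under eq_fun do rewrite expr2; rewrite expr2; apply: cvgM; exact: cc.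
Qed.

Section Moreau.
Variables (R : realType) (d : nat) (h : 'cV[R]_d -> R) (L : R).
Hypothesis h_lipschitz : forall u v, `|h u - h v| <= L * norm2 (u - v).
Hypothesis h_convex : forall u v t, 0 < t < 1 ->
  h (t *: u + (1 - t) *: v) <= t * h u + (1 - t) * h v.

(** [prox] specialized to a finite function; the argument keeps the shape in
    which [direction] applies [prox], so that the two agree by conversion. *)
Definition proxr (b : R) (z : 'cV[R]_d) : 'cV[R]_d :=
  prox (fun u => b%:E * (h u)%:E)%E z.

Definition moreau (b : R) (z : 'cV[R]_d) : R :=
  h (proxr b z) + (2 * b)^-1 * norm2 (proxr b z - z) ^+ 2.

Definition moreau_grad (b : R) (z : 'cV[R]_d) : 'cV[R]_d :=
  b^-1 *: (z - proxr b z).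

(** Minimize over a compact ball around [z]: outside radius [2 * b * |L|] the
    quadratic outgrows the at most linear decrease of [b * h], so the value
    there is at least the value at [z]. *)
Lemma prox_objective_min (b : R) (z : 'cV[R]_d) : 0 < b ->
  exists p, forall u, b * h p + 2^-1 * norm2 (p - z) ^+ 2 <=
                      b * h u + 2^-1 * norm2 (u - z) ^+ 2.
Proof.
move=> b0; pose phi u := b * h u + 2^-1 * norm2 (u - z) ^+ 2.
have h_cont : continuous h by exact: lipschitz2_continuous h_lipschitz.
have norm_cont : continuous (fun u : 'cV[R]_d => norm2 (u - z)).
  apply: (@lipschitz2_continuous _ _ _ 1) => u v; rewrite mul1r.
  apply: (le_trans (norm2_lipschitz _ _)).
  by rewrite opprB addrA subrK.
have phi_cont : continuous phi by exact: continuous_quadratic.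
have r_ge0 : 0 <= 2 * b * `|L| by rewrite mulr_ge0// mulr_ge0// ltW.
have [|||p _ pmin] := @compact_EVT_min _ _ phi [set u | `|u - z| <= 2 * b * `|L|].
- by exists z; rewrite /= subrr normr0.
- exact: closed_ball_compact.
- exact: continuous_subspaceT.
exists p => u; have [uz|uz] := leP `|u - z| (2 * b * `|L|).
  by apply: pmin; rewrite inE.
have far : 2 * b * `|L| <= norm2 (u - z).
  exact: (le_trans (ltW uz) (mxnorm_le_norm2 _)).
apply: (@le_trans _ _ (phi z)).
  by apply: pmin; rewrite inE /= subrr normr0.
rewrite /phi subrr norm20.
have : h z - h u <= `|L| * norm2 (u - z).
  rewrite norm2_distC; apply: (le_trans (ler_norm _)).
  apply: (le_trans (h_lipschitz _ _)).
  by rewrite ler_wpM2r ?norm2_ge0// ler_norm.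
move=> /(ler_wpM2l (ltW b0)).
by have := norm2_ge0 (u - z); move: (norm2 _) `|L| far => t l; nra.
Qed.

Lemma proxr_min (b : R) (z u : 'cV[R]_d) : 0 < b ->
  b * h (proxr b z) + 2^-1 * norm2 (proxr b z - z) ^+ 2 <=
  b * h u + 2^-1 * norm2 (u - z) ^+ 2.
Proof.
move=> b0; rewrite /proxr /prox.
case: xgetP => [p _ [_ /(_ u I)]|none].
  by rewrite -!EFinM -!EFinD lee_fin.
have [p pmin] := prox_objective_min z b0.
by case: (none p); split=> // w _; rewrite -!EFinM -!EFinD lee_fin; exact: pmin.
Qed.

Lemma moreau_le (b : R) (z u : 'cV[R]_d) : 0 < b ->
  moreau b z <= h u + (2 * b)^-1 * norm2 (u - z) ^+ 2.
Proof.
move=> b0; have half : b * (2 * b)^-1 = 2^-1.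
  by field; rewrite gt_eqF.
rewrite -(ler_pM2l b0) /moreau !mulrDr [X in _ + X]mulrA [X in _ <= _ + X]mulrA.
by rewrite half proxr_min.
Qed.

Lemma moreauE (b : R) (z : 'cV[R]_d) : 0 < b ->
  moreau b z = h (proxr b z) + b / 2 * norm2 (moreau_grad b z) ^+ 2.
Proof.
move=> b0; rewrite /moreau /moreau_grad norm2Z exprMn norm2_distC.
rewrite gtr0_norm ?invr_gt0//; field.
by rewrite gt_eqF.
Qed.

(** Compare the minimizer [p] of the proximal problem with the point
    [p + t *: (w - p)]: by convexity of [h] the variation
    divided by [t] is at least [0] up to a term in [t], which vanishes as [t]
    tends to 0. *)
Lemma moreau_grad_subgradient (b : R) (z w : 'cV[R]_d) : 0 < b ->
  h (proxr b z) + dotv (moreau_grad b z) (w - proxr b z) <= h w.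
Proof.
move=> b0; set p := proxr b z.
rewrite dotvZl -lerBrDl mulrC ler_pdivrMr//.
rewrite -(subr_ge0 _ (_ * b)); set e := (X in 0 <= X).
have eE : e = b * (h w - h p) + dotv (p - z) (w - p).
  by rewrite /e -(opprB p z) dotvNl; ring.
have small t : 0 < t < 1 -> 0 <= e + t * norm2 (w - p) ^+ 2.
  move=> t01; have /andP[t0 t1] := t01.
  have := proxr_min z (t *: w + (1 - t) *: p) b0; rewrite -/p.
  have -> : t *: w + (1 - t) *: p - z = (p - z) + t *: (w - p).
    by rewrite scalerBl scale1r scalerBr; apply/colP => i; rewrite !mxE; ring.
  rewrite (norm2_sqrD (p - z)) norm2Z gtr0_norm// dotvZr eE => hmin.
  have := ler_wpM2l (ltW b0) (h_convex w p t01).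
  rewrite -(pmulr_rge0 _ t0).
  move: (dotv _ _) (norm2 (w - p)) (norm2 (p - z)) hmin => a m c hmin hc.
  have := mulr_ge0 (mulr_ge0 (ltW t0) (ltW t0)) (sqr_ge0 m).
  by nra.
rewrite leNgt; apply/negP => e0.
pose m := norm2 (w - p) ^+ 2; have m0 : 0 <= m by exact: sqr_ge0.
(* If [e < 0], then [t = - e / (m - e + 1)] is in ]0, 1[ and [t * m < - e]. *)
have D0 : 0 < m - e + 1 by lra.
have := small (- e / (m - e + 1)); rewrite divr_gt0 ?oppr_gt0//= ltr_pdivrMr//.
rewrite mul1r -/m leNgt => neg; suff /negP : ~~ (e + - e / (m - e + 1) * m < 0).
  by apply; rewrite -(ltr_pM2r D0) mul0r mulrDl mulrAC divfK ?gt_eqF//; nra.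
by apply: neg; lra.
Qed.

(** The proximal point of [z] is a competitor in the minimization that defines
    the envelope at [z']; expanding the square around [z] gives the bound. *)
Lemma moreau_smooth (b : R) (z z' : 'cV[R]_d) : 0 < b ->
  moreau b z' <= moreau b z + dotv (moreau_grad b z) (z' - z) +
                 (2 * b)^-1 * norm2 (z' - z) ^+ 2.
Proof.
move=> b0; apply: (le_trans (moreau_le z' (proxr b z) b0)).
rewrite /moreau; set p := proxr b z.
have -> : p - z' = (p - z) - (z' - z) by rewrite opprB addrA subrK.
rewrite (norm2_sqrD (p - z)) dotvNr norm2N.
rewrite /moreau_grad -/p -(opprB p z) scalerN dotvNl dotvZl le_eqVlt; apply/orP; left.
apply/eqP; field.
by rewrite gt_eqF.
Qed.

(** The subgradient inequality at the proximal point [p], recentered at [z]: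
    since [z - p = b *: q], it loses [b * |q|^2], of which half is the gap
    between [h p] and the envelope. *)
Lemma moreau_grad_support (b : R) (z w : 'cV[R]_d) : 0 < b ->
  moreau b z + dotv (moreau_grad b z) (w - z) <=
    h w - b / 2 * norm2 (moreau_grad b z) ^+ 2.
Proof.
move=> b0; have := moreau_grad_subgradient z w b0.
rewrite moreauE//; set p := proxr b z; set q := moreau_grad b z.
have -> : w - p = (w - z) + b *: q.
  by rewrite /q /moreau_grad scalerA mulfV ?gt_eqF// scale1r addrA subrK.
by rewrite dotvDr dotvZr -norm2_sqr; lra.
Qed.

(** In dual form the envelope is the supremum over [y] of
    [dotv y z - h^* y - b / 2 * |y|^2], attained at the gradient [q]; keeping
    [y = q] for the parameter [b'] gives the bound.  The proof evaluates the
    supporting inequality of [q] at the proximal point for [b'] instead of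
    using conjugates. *)
Lemma moreau_change_param (b b' : R) (z : 'cV[R]_d) : 0 < b -> 0 < b' ->
  moreau b z <= moreau b' z + (b' - b) / 2 * norm2 (moreau_grad b z) ^+ 2.
Proof.
move=> b0 b0'; set q := moreau_grad b z.
have := moreau_grad_support z (proxr b' z) b0; rewrite -/q.
rewrite [moreau b' z]moreauE//; set q' := moreau_grad b' z.
have -> : proxr b' z - z = - (b' *: q').
  by rewrite /q' /moreau_grad scalerA mulfV ?gt_eqF// scale1r opprB.
rewrite dotvNr dotvZr.
have := sqr_ge0 (norm2 (q' - q)); rewrite norm2_sqrD dotvNr norm2N (dotvC q').
by move=> /(mulr_ge0 (ltW b0')); nra.
Qed.

(** A Lipschitz function drops by at most [L * b * |q|] between [z] and its
    proximal point, and [L * b * |q| <= b / 2 * (|q|^2 + L^2)]. *)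
Lemma moreau_lower (b : R) (z : 'cV[R]_d) : 0 < b ->
  h z <= moreau b z + b / 2 * L ^+ 2.
Proof.
move=> b0; rewrite moreauE//; set q := moreau_grad b z.
have := le_trans (ler_norm _) (h_lipschitz z (proxr b z)).
have -> : z - proxr b z = b *: q.
  by rewrite /q /moreau_grad scalerA mulfV ?gt_eqF// scale1r.
rewrite norm2Z gtr0_norm// => hL.
have := mulr_ge0 (ltW b0) (sqr_ge0 (norm2 q - L)); nra.
Qed.

End Moreau.

(** * Smooth convex functions on a convex set *)

Lemma convex_segment (R : realType) (n : nat) (X : set 'cV[R]_n) x y (t : R) :
  convex_set X -> X x -> X y -> 0 <= t <= 1 -> X (x + t *: (y - x)).
Proof.
move=> cX Xx Xy t01; pose l : {i01 R} := Itv01 (proj1 (andP t01)) (proj2 (andP t01)).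
have := cX y x l; rewrite !inE => /(_ Xy Xx); congr (X _).
rewrite /conv /= /unstable.onem; apply/colP => i; rewrite !mxE; ring.
Qed.

Section Smooth.
Variables (R : realType) (n : nat) (X : set 'cV[R]_n) (f : 'cV[R]_n -> \bar R).
Variable Lf : R.
Hypothesis X_convex : convex_set X.
Hypothesis f_smooth : smooth_on X f Lf.
Hypothesis f_convex : forall (x y : 'cV[R]_n) (t : R), (0 < t < 1)%R ->
  (f (t *: x + (1 - t) *: y)%R <= t%:E * f x + (1 - t)%:E * f y)%E.

Lemma smooth_fin x : X x -> f x = (fine (f x))%:E.
Proof. by move=> /(f_smooth.1) [/nbhs_singleton fx _]; rewrite fineK. Qed.

(** Along a line the difference quotients of [f] are those of the directional
    derivative, and [grad] lists the partial derivatives. *)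
Lemma is_derive_line x v (t : R) : ediff f (x + t *: v) ->
  is_derive t 1 (fun s : R => fine (f (x + s *: v)) : R^o)
    (dotv (grad f (x + t *: v)) v).
Proof.
move=> [_ fd]; set y := x + t *: v in fd *.
have dE : 'd (fine \o f : 'cV[R]_n -> R^o) y v = dotv (grad f y) v.
  have vE : v = \sum_(i < n) v i 0 *: delta_mx i 0.
    by rewrite {1}(matrix_sum_delta v); apply: eq_bigr => i _; rewrite big_ord1.
  rewrite {1}vE linear_sum; apply: eq_bigr => i _.
  by rewrite linearZ /grad mxE; exact: mulrC.
have := @diff_derivable _ _ _ _ _ v fd.
have := @deriveE _ _ _ _ _ v fd.
rewrite dE => <-.
have quotE : (fun r : R => r^-1 *: ((fine \o f : 'cV[R]_n -> R^o) (r *: v + y)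
                                    - (fine \o f) y)) =
    (fun r : R => r^-1 *: ((fun s : R => fine (f (x + s *: v)) : R^o) (r *: 1 + t)
                           - fine (f y))).
  apply/funext => r /=; congr (_ *: (fine (f _) - _)).
  by rewrite /y scalerDl addrCA [r *: 1]mulr1.
rewrite /derivable /derive quotE => df.
exact: DeriveDef.
Qed.

Lemma is_derive_quadratic (a c t : R) :
  is_derive t 1 (fun s : R => a * s + c * s ^+ 2 : R^o) (a + 2 * c * t).
Proof.
have -> : (fun s : R => a * s + c * s ^+ 2 : R^o) = (a \*: id) + (c \*: (id ^+ 2)).
  by apply/funext => s.
apply: is_derive_eq.
by rewrite /GRing.scale /=; ring.
Qed.

(** Mean value theorem for [psi], the restriction of [f] to the segment minus
    the quadratic on the right: Lipschitz continuity of the gradient makes its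
    derivative nonpositive, so [psi 1 <= psi 0]. *)
Lemma smooth_descent x y : X x -> X y ->
  fine (f y) <= fine (f x) + dotv (grad f x) (y - x) + Lf / 2 * norm2 (y - x) ^+ 2.
Proof.
move=> Xx Xy; set v := y - x.
pose a := dotv (grad f x) v; pose c := Lf / 2 * norm2 v ^+ 2.
pose psi (s : R) := fine (f (x + s *: v)) - (a * s + c * s ^+ 2).
pose dpsi (s : R) := dotv (grad f (x + s *: v)) v - (a + 2 * c * s).
have Xs (s : R) : 0 <= s <= 1 -> X (x + s *: v) by exact: convex_segment.
have psi_derive (s : R) : 0 <= s <= 1 -> is_derive s 1 (psi : R -> R^o) (dpsi s).
  move=> s01; apply: is_deriveB; last exact: is_derive_quadratic.
  by apply: is_derive_line; apply: f_smooth.1; exact: Xs.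
have [|s s01||s] := @MVT R psi dpsi 0 1.
- exact: ltr01.
- by apply: psi_derive; move: s01; rewrite in_itv /= => /andP[/ltW -> /ltW ->].
- apply: derivable_within_continuous => s; rewrite in_itv /= => s01.
  by have [] := psi_derive _ s01.
rewrite in_itv /= => /andP[s0 s1].
rewrite subr0 mulr1 /psi scale1r scale0r addr0 [x + v]addrC subrK => mvt.
have : dotv (grad f (x + s *: v)) v - a <= 2 * c * s.
  rewrite /a -dotvNl -dotvDl; apply: (le_trans (cauchy_schwarz _ _)).
  have := f_smooth.2 _ _ (Xs s _) Xx => /(_ _)/(ler_wpM2r (norm2_ge0 v)).
  rewrite [x + _]addrC addrK norm2Z gtr0_norm//.
  rewrite (ltW s0) (ltW s1) => /(_ isT)/le_trans; apply.
  by rewrite /c; lra.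
move=> slope; rewrite /dpsi in mvt; rewrite -[leRHS]/(fine (f x) + a + c).
by move: (dotv (grad f (x + _)) _) mvt slope => D; lra.
Qed.

(** For [0 < r < 1] convexity bounds the difference quotients of [f] along
    [y - x] by [f y - f x]; let [r] tend to 0 from the right. *)
Lemma smooth_convex_gradient x y : X x -> X y ->
  fine (f x) + dotv (grad f x) (y - x) <= fine (f y).
Proof.
move=> Xx Xy; set v := y - x.
have fx : ediff f (x + 0 *: v) by rewrite scale0r addr0; exact: f_smooth.1.
have [fd fD] := is_derive_line fx.
move: fD; rewrite scale0r addr0 => <-; rewrite addrC -lerBrDr.
apply: (cvgr_to_le (cvg_dnbhs_at_right fd)).
near=> r.
have r0 : 0 < r by [].
have r1 : r < 1 by near: r; apply: nbhs_right_lt; exact: ltr01.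
rewrite /= addr0 scale0r addr0 [r%:A]mulr1 [leLHS]mulrC ler_pdivrMr//.
have r01 : 0 < r < 1 by rewrite r0.
have := f_convex y x r01.
have -> : r *: y + (1 - r) *: x = x + r *: v.
  by rewrite scalerBl scale1r scalerBr addrCA.
rewrite (smooth_fin Xx) (smooth_fin Xy) (@smooth_fin (x + _)); last first.
  by apply: convex_segment => //; rewrite !ltW.
by rewrite -!EFinM -EFinD lee_fin; lra.
Unshelve. all: end_near. Qed.

End Smooth.

(** A negative Lipschitz constant is possible only if [X] is a single point. *)
Lemma smooth_constant_ge0_or_diam0 (R : realType) (n : nat) (X : set 'cV[R]_n)
    (f : 'cV[R]_n -> \bar R) (Lf : R) :
  X !=set0 -> smooth_on X f Lf -> 0 <= Lf \/ diam X = 0.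
Proof.
move=> [x0 Xx0] [_ fL]; have [Lf0|Lf0] := leP 0 Lf; [by left|right].
have same x y : X x -> X y -> norm2 (x - y) = 0.
  move=> Xx Xy; have := le_trans (norm2_ge0 _) (fL x y Xx Xy).
  by rewrite nmulr_rge0// => h; apply/le_anti; rewrite h norm2_ge0.
rewrite /diam (_ : [set _ | _ in _] = [set 0]) ?sup1//.
apply/seteqP; split=> [_ [[x y] /= [Xx Xy] <-]|_ ->]; first exact: same.
by exists (x0, x0) => //=; exact: same.
Qed.

(** * One step on the smoothed objective *)

Section Step.
Variables (R : realType) (n d : nat) (X : set 'cV[R]_n).
Variables (f : 'cV[R]_n -> \bar R) (h : 'cV[R]_d -> R) (A : 'M[R]_(d, n)).
Variables (Lf L : R).
Hypothesis X_compact : compact X.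
Hypothesis X_convex : convex_set X.
Hypothesis f_smooth : smooth_on X f Lf.
Hypothesis f_convex : forall (x y : 'cV[R]_n) (t : R), (0 < t < 1)%R ->
  (f (t *: x + (1 - t) *: y)%R <= t%:E * f x + (1 - t)%:E * f y)%E.
Hypothesis h_lipschitz : forall u v, `|h u - h v| <= L * norm2 (u - v).
Hypothesis h_convex : forall u v t, 0 < t < 1 ->
  h (t *: u + (1 - t) *: v) <= t * h u + (1 - t) * h v.

Let D := diam X.
Let N := spectral_norm A.

Definition smoothed (b : R) (x : 'cV[R]_n) : R :=
  fine (f x) + moreau h b (A *m x).

Definition smoothed_grad (b : R) (x : 'cV[R]_n) : 'cV[R]_n :=
  grad f x + A^T *m moreau_grad h b (A *m x).

Lemma dotv_smoothed_grad b x v :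
  dotv (smoothed_grad b x) v =
  dotv (grad f x) v + dotv (moreau_grad h b (A *m x)) (A *m v).
Proof. by rewrite dotvDl dotv_trmx_mul. Qed.

Lemma smoothed_descent b x y : 0 < b -> X x -> X y ->
  smoothed b y <= smoothed b x + dotv (smoothed_grad b x) (y - x) +
    (Lf + N ^+ 2 / b) / 2 * norm2 (y - x) ^+ 2.
Proof.
move=> b0 Xx Xy; rewrite dotv_smoothed_grad mulmxBr.
have := smooth_descent X_convex f_smooth Xx Xy.
have := moreau_smooth h_lipschitz (A *m x) (A *m y) b0.
have : (2 * b)^-1 * norm2 (A *m y - A *m x) ^+ 2 <=
       N ^+ 2 / b / 2 * norm2 (y - x) ^+ 2.
  rewrite [X in _ <= X](_ : _ = (2 * b)^-1 * (N * norm2 (y - x)) ^+ 2).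
    rewrite ler_pM2l ?invr_gt0 ?mulr_gt0// -mulmxBr.
    rewrite ler_pXn2r ?nnegrE ?norm2_ge0// ?norm2_mulmx_le//.
    exact: le_trans (norm2_ge0 _) (norm2_mulmx_le _ _).
  by field; rewrite gt_eqF.
rewrite /smoothed [(Lf + _) / 2]mulrDl mulrDl; lra.
Qed.

Lemma smoothed_gap b x y : 0 < b -> X x -> X y ->
  smoothed b x + dotv (smoothed_grad b x) (y - x) <=
    fine (f y) + h (A *m y) - b / 2 * norm2 (moreau_grad h b (A *m x)) ^+ 2.
Proof.
move=> b0 Xx Xy; rewrite dotv_smoothed_grad mulmxBr /smoothed.
have := smooth_convex_gradient X_convex f_smooth f_convex Xx Xy.
have := moreau_grad_support h_lipschitz h_convex (A *m x) (A *m y) b0.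
lra.
Qed.

(** The oracle tolerance is [delta] times the curvature term of the descent
    bound, divided by [eta]; the two add up to the factor [1 + delta]. *)
Lemma cgm_step b eta delta x st y : 0 < b -> 0 <= eta <= 1 ->
  X x -> X st -> X y ->
  dotv (smoothed_grad b x) st <= dotv (smoothed_grad b x) y +
    delta * (eta / 2) * D ^+ 2 * (Lf + N ^+ 2 / b) ->
  smoothed b (x + eta *: (st - x)) <=
    (1 - eta) * smoothed b x + eta * (fine (f y) + h (A *m y))
    - eta * b / 2 * norm2 (moreau_grad h b (A *m x)) ^+ 2
    + eta ^+ 2 / 2 * D ^+ 2 * (Lf + N ^+ 2 / b) * (1 + delta).
Proof.
move=> b0 eta01 Xx Xst Xy oracle; have /andP[eta0 _] := eta01.
have := smoothed_descent b0 Xx (convex_segment X_convex Xx Xst eta01).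
rewrite [x + _]addrC addrK [_ + x]addrC norm2Z ger0_norm// dotvZr.
have := ler_wpM2l eta0 (smoothed_gap b0 Xx Xy).
have curvature : (Lf + N ^+ 2 / b) * norm2 (st - x) ^+ 2 <=
                 (Lf + N ^+ 2 / b) * D ^+ 2.
  have len : norm2 (st - x) <= D by exact: norm2_le_diam.
  have [Lf0|D0] : 0 <= Lf \/ D = 0.
  - by apply: (@smooth_constant_ge0_or_diam0 _ _ _ f) => //; exists x.
  - apply: ler_wpM2l; first by rewrite addr_ge0// divr_ge0 ?sqr_ge0 ?ltW.
    by rewrite ler_pXn2r ?nnegrE ?norm2_ge0// (le_trans (norm2_ge0 _) len).
  - suff -> : norm2 (st - x) = 0 by rewrite D0.
    by apply/le_anti; rewrite norm2_ge0 andbT -D0.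
have := ler_wpM2l (mulr_ge0 eta0 eta0) curvature.
have := ler_wpM2l eta0 oracle.
rewrite !(dotvDr _ st) !(dotvDr _ y) !dotvNr.
move: (Lf + _) (dotv _ st) (dotv _ y) (dotv _ x) (norm2 (st - x)) => K a c e m.
move: (smoothed _ _) (smoothed _ _) (fine _ + _) (norm2 _ ^+ 2) D => u1 u2 u3 Q D'.
by lra.
Qed.

End Step.

(** * Convergence of the iterates *)

(** The induction step in pure real arithmetic: [p = sqrt j],
    [q = sqrt (j + 1)], [Q = |q_j|^2], [S0] and [S1] are the gaps at [x_j] for
    the parameters [beta_(j-1)] and [beta_j], and [S'] is the gap at [x_(j+1)]
    for [beta_j].  The terms in [Q] do not add up to a positive amount because
    [(p^2 - 1) * (q - p) <= 2 * p], that is [q * (p^2 - 1 - p * q) <= 0]. *)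
Lemma rate_recursion (R : realType) (p q b0 delta E M Q S0 S1 S' : R) :
  0 < p -> q ^+ 2 = p ^+ 2 + 1 -> p <= q -> 1 <= p -> 0 < b0 -> 0 <= delta ->
  0 <= E -> 0 <= M -> 0 <= Q ->
  S1 <= S0 + (b0 / p - b0 / q) / 2 * Q ->
  S' <= (1 - 2 / q ^+ 2) * S1 - 2 / q ^+ 2 * (b0 / q) / 2 * Q
        + (2 / q ^+ 2) ^+ 2 / 2 * (E + M / (b0 / q)) * (1 + delta) ->
  (p ^+ 2 - 1) * p ^+ 2 * S0 <= 2 * (p ^+ 2 - 1) * (1 + delta) * (E + M * p / b0) ->
  p ^+ 2 * q ^+ 2 * S' <= 2 * p ^+ 2 * (1 + delta) * (E + M * q / b0).
Proof.
move=> p0 qp pq p1 b00 d0 E0 M0 Q0 S1le S'le S0le.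
have q0 : 0 < q by exact: lt_le_trans pq.
have p21 : 0 <= p ^+ 2 - 1 by nra.
have -> : p ^+ 2 * q ^+ 2 * S' = p ^+ 2 * (q ^+ 2 * S') by rewrite mulrA.
have S'2 : p ^+ 2 * (q ^+ 2 * S') <= p ^+ 2 * ((p ^+ 2 - 1) * S1 - b0 / q * Q
   + 2 / q ^+ 2 * (E + M * q / b0) * (1 + delta)).
  rewrite ler_pM2l ?exprn_gt0//.
  apply: le_trans (ler_wpM2l (ltW (exprn_gt0 2 q0)) S'le) _.
  have -> : p ^+ 2 - 1 = q ^+ 2 - 2 by rewrite qp; ring.
  rewrite le_eqVlt; apply/orP; left; apply/eqP; field.
  by rewrite !gt_eqF.
apply: le_trans S'2 _.
have S1le' := ler_wpM2l (mulr_ge0 (sqr_ge0 p) p21) S1le.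
have drop : p ^+ 2 * (p ^+ 2 - 1) * ((b0 / p - b0 / q) / 2 * Q) <=
    p ^+ 2 * (b0 / q * Q).
  rewrite -mulrA ler_pM2l ?exprn_gt0//.
  rewrite mulrA ler_wpM2r//.
  rewrite -(ler_pM2r (mulr_gt0 p0 q0)).
  have -> : (p ^+ 2 - 1) * ((b0 / p - b0 / q) / 2) * (p * q) =
     b0 / 2 * ((p ^+ 2 - 1) * (q - p)) by field; rewrite !gt_eqF.
  have -> : b0 / q * (p * q) = b0 / 2 * (2 * p) by field; rewrite !gt_eqF.
  rewrite ler_wpM2l ?divr_ge0 ?ltW//.
  nra.
have ME : 0 <= M / b0 by rewrite divr_ge0// ltW.
have last : (p ^+ 2 - 1) * (E + M * p / b0) + p ^+ 2 * (q ^+ 2)^-1 * (E + M * q / b0)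
    <= p ^+ 2 * (E + M * q / b0).
  have : (p ^+ 2 - 1) * (E + M * p / b0) <= (p ^+ 2 - 1) * (E + M * q / b0).
    rewrite ler_wpM2l// lerD2l ![M * _]mulrC -!mulrA ler_wpM2r//.
  have : p ^+ 2 * (q ^+ 2)^-1 * (E + M * q / b0) <= 1 * (E + M * q / b0).
    rewrite ler_wpM2r//; first by rewrite addr_ge0// mulrAC mulr_ge0// ltW.
    by rewrite ler_pdivrMr ?exprn_gt0// qp; lra.
  lra.
have := ler_wpM2l (mulr_ge0 (ler0n R 2) (addr_ge0 ler01 d0)) last.
move: S0le S1le' drop; rewrite -[b0 / q * Q]mulrA.
move: (E + M * p / b0) (E + M * q / b0) (b0 / p - b0 / q) => U V W.
move: (q ^+ 2)^-1 => iq2.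
by lra.
Qed.

Lemma eta01 (R : realType) k : (0 < k)%N -> 0 <= eta R k <= 1.
Proof.
by move=> k0; rewrite /eta divr_ge0//= ler_pdivrMr// mul1r ler_nat.
Qed.

Lemma beta_gt0 (R : realType) (b : R) k : 0 < b -> 0 < beta b k.
Proof. by move=> b0; rewrite divr_gt0// sqrtr_gt0. Qed.

Section Convergence.
Variables (R : realType) (n d : nat) (X : set 'cV[R]_n).
Variables (f : 'cV[R]_n -> \bar R) (h : 'cV[R]_d -> R) (A : 'M[R]_(d, n)).
Variables (Lf L beta0 delta : R) (x s st : nat -> 'cV[R]_n) (y : 'cV[R]_n).
Hypothesis X_compact : compact X.
Hypothesis X_convex : convex_set X.
Hypothesis f_smooth : smooth_on X f Lf.
Hypothesis f_convex : forall (x y : 'cV[R]_n) (t : R), (0 < t < 1)%R ->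
  (f (t *: x + (1 - t) *: y)%R <= t%:E * f x + (1 - t)%:E * f y)%E.
Hypothesis h_lipschitz : forall u v, `|h u - h v| <= L * norm2 (u - v).
Hypothesis h_convex : forall u v t, 0 < t < 1 ->
  h (t *: u + (1 - t) *: v) <= t * h u + (1 - t) * h v.
Hypothesis beta0_gt0 : 0 < beta0.
Hypothesis delta_ge0 : 0 <= delta.
Hypothesis x_cgm : inexact_cgm X f (EFin \o h) A Lf beta0 delta x s st.
Hypothesis Xy : X y.

Let D := diam X.
Let N := spectral_norm A.
Let Fy := fine (f y) + h (A *m y).

Lemma iterate_mem k : X (x k.+1).
Proof.
elim: k => [|k Xk]; first by case: x_cgm.
have [_ Xst _ ->] := x_cgm.2 k.+1 (ltn0Sn k).
by apply: convex_segment => //; exact: eta01.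
Qed.

Lemma smoothed_grad_direction b u : 0 < b ->
  b^-1 *: direction f (EFin \o h) A b u = smoothed_grad f h A b u.
Proof.
move=> b0; rewrite /direction scalerDr scalerA mulVf ?gt_eqF// scale1r.
by rewrite scalemxAr.
Qed.

Lemma oracle_step k (b := beta beta0 k.+1) (e := eta R k.+1) :
  smoothed f h A b (x k.+2) <= (1 - e) * smoothed f h A b (x k.+1) + e * Fy
    - e * b / 2 * norm2 (moreau_grad h b (A *m x k.+1)) ^+ 2
    + e ^+ 2 / 2 * D ^+ 2 * (Lf + N ^+ 2 / b) * (1 + delta).
Proof.
have b0 : 0 < b by exact: beta_gt0.
have [[_ s_min] Xst oracle ->] := x_cgm.2 k.+1 (ltn0Sn k).
apply: (cgm_step X_compact X_convex f_smooth f_convex h_lipschitz h_convex) => //.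
- exact: eta01.
- exact: iterate_mem.
rewrite -smoothed_grad_direction//; apply: (le_trans oracle).
rewrite lerD2r !dotvZl ler_pM2l ?invr_gt0//.
by have := s_min y Xy; rewrite lee_fin.
Qed.

(** At [k = 0] both sides vanish, so the induction starts without any bound
    on the initial gap. *)
Lemma smoothed_rate k :
  k%:R * k.+1%:R * (smoothed f h A (beta beta0 k) (x k.+1) - Fy) <=
  2 * k%:R * (1 + delta) *
    (Lf * D ^+ 2 + N ^+ 2 * D ^+ 2 * Num.sqrt k.+1%:R / beta0).
Proof.
elim: k => [|k IHk]; first by rewrite !(mul0r, mulr0).
pose p : R := Num.sqrt k.+1%:R; pose q : R := Num.sqrt k.+2%:R.
have p2 : p ^+ 2 = k.+1%:R by rewrite sqr_sqrtr.
have q2 : q ^+ 2 = k.+2%:R by rewrite sqr_sqrtr.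
have kE : k%:R = p ^+ 2 - 1 by rewrite p2 -natr1 addrK.
have E0 : 0 <= Lf * D ^+ 2.
  have [Lf0|D0] : 0 <= Lf \/ D = 0; last by rewrite D0 expr0n mulr0.
    by apply: (@smooth_constant_ge0_or_diam0 _ _ _ f) => //; exists y.
  by rewrite mulr_ge0 ?sqr_ge0.
move: IHk; rewrite -/p -/q -p2 -q2 kE => IHk.
have b1 : 0 < beta beta0 k by exact: beta_gt0.
have b2 : 0 < beta beta0 k.+1 by exact: beta_gt0.
apply: (rate_recursion (S0 := smoothed f h A (beta beta0 k) (x k.+1) - Fy)
  (S1 := smoothed f h A (beta beta0 k.+1) (x k.+1) - Fy)
  (Q := norm2 (moreau_grad h (beta beta0 k.+1) (A *m x k.+1)) ^+ 2)) => //.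
- by rewrite sqrtr_gt0.
- by rewrite p2 q2 natr1.
- by rewrite ler_wsqrtr// ler_nat.
- by rewrite -sqrtr1 ler_wsqrtr// ler1n.
- by rewrite mulr_ge0 ?sqr_ge0.
- exact: sqr_ge0.
- have := moreau_change_param h_lipschitz h_convex (A *m x k.+1) b2 b1.
  rewrite -[beta0 / p]/(beta beta0 k) -[beta0 / q]/(beta beta0 k.+1) /smoothed.
  by lra.
have := oracle_step k; rewrite /eta -q2.
move: (norm2 _ ^+ 2) (smoothed _ _ _ _ _) (smoothed _ _ _ _ _) => Q u v.
rewrite -[beta beta0 k.+1]/(beta0 / q).
by move: (2 / q ^+ 2) (beta0 / q) => e b; lra.
Qed.

Lemma cgm_rate k :
  fine (f (x k.+2)) + h (A *m x k.+2) - Fy <= rate D Lf N L delta beta0 k.+2.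
Proof.
pose r : R := Num.sqrt k.+2%:R.
have r0 : 0 < r by rewrite sqrtr_gt0.
have r2 : r ^+ 2 = k.+2%:R by rewrite sqr_sqrtr.
have b0 : 0 < beta beta0 k.+1 by exact: beta_gt0.
have k0 : 0 < k.+1%:R :> R by [].
have rateE : rate D Lf N L delta beta0 k.+2 =
    2 * (1 + delta) * (Lf * D ^+ 2 + N ^+ 2 * D ^+ 2 * r / beta0) / k.+2%:R
    + beta beta0 k.+1 / 2 * L ^+ 2.
  rewrite /rate /beta -/r -r2; field.
  by rewrite !gt_eqF.
have := smoothed_rate k.+1; rewrite -/r [2 * _]mulrC -!(mulrA k.+1%:R).
rewrite ler_pM2l// mulrC -ler_pdivlMr// rateE.
have := moreau_lower h_lipschitz (A *m x k.+2) b0.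
by rewrite /smoothed; move: (_ / k.+2%:R) (moreau _ _ _) => B m; lra.
Qed.

End Convergence.

(** * The optimal smoothing parameter *)

(** By the inequality of arithmetic and geometric means, [4 c^2 / b + b Lg^2] is
    at least [4 c Lg], with equality at [b = 2 c / Lg]; here
    [c = D * N * sqrt (1 + delta)]. *)
Lemma rate_minimizer (R : realType) (D Lf N Lg delta : R) :
  0 < D * N -> 0 < Lg -> 0 <= delta ->
  exists2 b : R, 0 < b & forall (b' : R) (k : nat), 0 < b' -> (0 < k)%N ->
    rate D Lf N Lg delta b k <= rate D Lf N Lg delta b' k.
Proof.
move=> DN0 Lg0 delta0; pose w := Num.sqrt (1 + delta).
have w0 : 0 < w by rewrite sqrtr_gt0 ltr_wpDr.
have w2 : 1 + delta = w ^+ 2 by rewrite sqr_sqrtr// addr_ge0.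
have b0 : 0 < 2 * (D * N) * w / Lg by rewrite divr_gt0// mulr_gt0// mulr_gt0.
exists (2 * (D * N) * w / Lg) => // b' k b'0 k0.
set b := 2 * (D * N) * w / Lg in b0 *; pose r : R := Num.sqrt k%:R.
have r0 : 0 < r by rewrite sqrtr_gt0 ltr0n.
pose c := D * N * w; have c0 : 0 < c by rewrite mulr_gt0.
have rateE t : 0 < t -> rate D Lf N Lg delta t k =
    2 * D ^+ 2 * (Lf / k%:R) * (1 + delta) + (4 * c ^+ 2 / t + t * Lg ^+ 2) / (2 * r).
  move=> t0; rewrite /rate -/r w2 /c; field.
  by rewrite pnatr_eq0 -lt0n k0 !gt_eqF.
rewrite !rateE// lerD2l ler_pM2r ?invr_gt0 ?mulr_gt0//.
have -> : 4 * c ^+ 2 / b + b * Lg ^+ 2 = 4 * (c * Lg).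
  have -> : b = 2 * c / Lg by rewrite /b /c; ring.
  by field; rewrite !gt_eqF.
rewrite -(ler_pM2r b'0) [leRHS]mulrDl divfK ?gt_eqF//.
have := sqr_ge0 (2 * c - b' * Lg); nra.
Qed.

(** * The rate for the original objective *)

Section Lipschitz.
Variables (R : realType) (d : nat) (g : 'cV[R]_d -> \bar R) (L : R).
Hypothesis g_lipschitz : elipschitz g L.

Lemma elipschitz_fin z : g z = (fine (g z))%:E.
Proof. by have := g_lipschitz z z; case: (g z). Qed.

Lemma elipschitz_fine u v : `|fine (g u) - fine (g v)| <= L * norm2 (u - v).
Proof.
by have := g_lipschitz u v; rewrite (elipschitz_fin u) (elipschitz_fin v).
Qed.

End Lipschitz.

Theorem theorem4p2 (R : realType) (n d : nat) (X : set 'cV[R]_n)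
    (f : 'cV[R]_n -> \bar R) (g : 'cV[R]_d -> \bar R) (A : 'M[R]_(d, n))
    (Lf Lg beta0 delta : R) (x s st : nat -> 'cV[R]_n) (xstar : 'cV[R]_n)
    (X_nonempty : X !=set0)
    (X_compact : compact X)
    (X_convex : convex_set X)
    (f_pcc : proper_closed_convex f)
    (f_smooth : smooth_on X f Lf)
    (g_pcc : proper_closed_convex g)
    (g_lipschitz : elipschitz g Lg)
    (xstar_min : argmin X (objective f g A) xstar)
    (beta0_gt0 : 0 < beta0)
    (delta_gt0 : 0 < delta)
    (x_cgm : inexact_cgm X f g A Lf beta0 delta x s st) :
  (forall k : nat, (1 < k)%N ->
    (objective f g A (x k) - objective f g A xstar <=
      (rate (diam X) Lf (spectral_norm A) Lg delta beta0 k)%:E)%E) /\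
  (0 < diam X * spectral_norm A -> 0 < Lg ->
    exists2 b : R, 0 < b & forall (b' : R) (k : nat), 0 < b' -> (0 < k)%N ->
      rate (diam X) Lf (spectral_norm A) Lg delta b k <=
      rate (diam X) Lf (spectral_norm A) Lg delta b' k).
Proof.
split; last by move=> DN Lg0; exact: rate_minimizer (ltW delta_gt0).
pose h z := fine (g z).
have gE : g = EFin \o h by apply/funext => z; exact: elipschitz_fin g_lipschitz z.
have h_lipschitz u v : `|h u - h v| <= Lg * norm2 (u - v).
  exact: elipschitz_fine.
have h_convex u v t : 0 < t < 1 ->
    h (t *: u + (1 - t) *: v) <= t * h u + (1 - t) * h v.
  move=> t01; have [_ _ _ /(_ u v t t01)] := g_pcc.
  by rewrite gE /= -!EFinM -EFinD lee_fin.
have [_ _ _ f_convex] := f_pcc.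
have [Xs _] := xstar_min.
clearbody h; move: x_cgm; rewrite gE => {}x_cgm [|[|k]] // _.
have Xk : X (x k.+2).
  exact: (iterate_mem X_convex x_cgm).
rewrite /objective /= (smooth_fin f_smooth Xk) (smooth_fin f_smooth Xs).
rewrite -!EFinD lee_fin.
exact: (cgm_rate X_compact X_convex f_smooth f_convex h_lipschitz h_convex
  beta0_gt0 (ltW delta_gt0) x_cgm Xs).
Qed.
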